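(* Let $\mathcal N$ be a Newton polyhedra system. Then there is a finite sequence of total transforms $$\mathcal N \rightarrow \mathcal N_1 \rightarrow \mathcal N_2 \rightarrow \cdots \rightarrow \mathcal N_k$$ (each system being the total transform of the preceding one centered in some non-empty stratum of the preceding one) such that $\mathcal N_k$ has normal crossings.
   Context: Support fabrics. For a finite set $I$, $\mathcal P(I)$ denotes its power set. A support fabric is a pair $\mathcal F=(I,\mathcal H)$ with $I$ finite and $\mathcal H\subset\mathcal P(I)$ such that $J\in\mathcal H$ implies $\mathcal P(J)\subset\mathcal H$. Elements of $\mathcal H$ are called strata. Blow-up. Let $J\in\mathcal H$ be non-empty. Put $I'=I\cup\{\infty\}$ with $\infty\notin I$. Let $\mathcal H'_s=\{K\in\mathcal H: J\not\subset K\}$; for $K\in\mathcal H$ with $K\supset J$ let $\mathcal H'^K_\infty=\{(K\setminus J)\cup A\cup\{\infty\}: A\subsetneq J\}$; let $\mathcal H'_\infty=\bigcup_{K\in\mathcal H,K\supset J}\mathcal H'^K_\infty$ and $\mathcal H'=\mathcal H'_s\cup\mathcal H'_\infty$. The blow-up is the support fabric $\pi_J(\mathcal F)=(I',\mathcal H')$. The map $\pi_J^\#:\mathcal H'\to\mathcal H$ is defined by $\pi_J^\#(J')=J'$ if $J'\in\mathcal H'_s$ and $\pi_J^\#(J')=K$ if $J'\in\mathcal H'^K_\infty$. Polyhedra systems. For a finite set $J$ and $A\subset\mathbb R^J_{\ge0}$, let $[[A]]$ be the convex hull of $A+\mathbb R^J_{\ge0}$. For an integer $d\ge1$, a characteristic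 polyhedron with denominator $d$ is a set $\Delta=[[A]]\subset\mathbb R^J_{\ge0}$ with $A\subset\frac1d\mathbb Z^J_{\ge0}$; all polyhedra are assumed non-empty. A polyhedra system with denominator $d$ is $\mathcal D=(\mathcal F;\{\Delta_J\}_{J\in\mathcal H},d)$, where $\mathcal F=(I,\mathcal H)$ is a support fabric, each $\Delta_J\subset\mathbb R^J_{\ge0}$ is a characteristic polyhedron with denominator $d$, and $\Delta_{J_1}=\mathrm{pr}_{J_2,J_1}(\Delta_{J_2})$ whenever $J_1\subset J_2$ are in $\mathcal H$, with $\mathrm{pr}_{J_2,J_1}(\sigma)=\sigma|_{J_1}$. It is a Newton polyhedra system if $d=1$. Total transform. For $J\in\mathcal H$ non-empty, $J'\in\mathcal H'_\infty$ and $K=\pi_J^\#(J')$, define $\lambda_{J'}:\mathbb R^K\to\mathbb R^{J'}$ by $\lambda_{J'}(\sigma)(j)=\sigma(j)$ for $j\ne\infty$ and $\lambda_{J'}(\sigma)(\infty)=\sum_{j\in J}\sigma(j)$. The total transform of $\mathcal D$ centered in $J$ is $\Lambda^0_J(\mathcal D)=(\pi_J(\mathcal F);\{\Delta^0_{J'}\}_{J'\in\mathcal H'},d)$ with $\Delta^0_{J'}=\Delta_{J'}$ if $J'\in\mathcal H'_s$, and $\Delta^0_{J'}=[[\lambda_{J'}(\Delta_K)]]$ if $J'\in\mathcal H'_\infty$, $K=\pi_J^\#(J')$. Normal crossings. A Newton polyhedra system $(\mathcal F;\{N_J\}_{J\in\mathcal H},1)$ has normal crossings if each $N_J$, $J\in\mathcal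 H$, has a single vertex. Finite sequences of transforms may have length zero. *)

(* Defs.v *)
From HB Require Import structures.
From mathcomp Require Import all_boot all_order all_algebra.
From mathcomp Require Import mathcomp_extra unstable boolp classical_sets reals interval_inference convex.
From mathcomp Require Import ring.

Set Implicit Arguments.
Unset Strict Implicit.
Unset Printing Implicit Defensive.

Import Order.TTheory GRing.Theory Num.Theory.

Local Open Scope classical_set_scope.
Local Open Scope ring_scope.

Record support_fabric := SupportFabric {
  index_set : finType;
  strata : {set {set index_set}};
  strata_down : forall J K : {set index_set},
    J \in strata -> K \subset J -> K \in strata
}.

(* The blown-up index set I' = I + {oo} is [option I], with [None] as oo and a
   subset K of I identified with [Some @: K]. *)
Section BlowUpSets.
Variables (I : finType) (H : {set {set I}}) (J : {set I}).

Definition blowup_s : {set {set option I}} :=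
  [set Some @: K | K : {set I} in H & ~~ (J \subset K)].

Definition blowup_inf_at (K : {set I}) : {set {set option I}} :=
  [set None |: Some @: ((K :\: J) :|: A) | A : {set I} & A \proper J].

Definition blowup_inf : {set {set option I}} :=
  \bigcup_(K in H | J \subset K) blowup_inf_at K.

Definition blowup_strata : {set {set option I}} := blowup_s :|: blowup_inf.

(* The stratum K is unique when it exists, see [blowup_map_inf]. *)
Definition blowup_map (J' : {set option I}) : {set I} :=
  if [pick K in H | (J \subset K) && (J' \in blowup_inf_at K)] is Some K
  then K else Some @^-1: J'.

Lemma mem_preimSome (J' : {set option I}) j :
  (j \in Some @^-1: J') = (Some j \in J').
Proof. by rewrite inE. Qed.

Lemma mem_imSome (K : {set I}) j : (Some j \in Some @: K) = (j \in K).
Proof. by rewrite mem_imset // => x y []. Qed.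

Lemma None_imSome (K : {set I}) : (None \in Some @: K) = false.
Proof. by apply/negbTE/imsetP => -[]. Qed.

Lemma imSomeK (J' : {set option I}) :
  None \notin J' -> Some @: (Some @^-1: J') = J'.
Proof.
move=> nJ; apply/setP => -[j|]; first by rewrite mem_imSome inE.
by rewrite None_imSome (negbTE nJ).
Qed.

Lemma preimSomeK (K : {set I}) : Some @^-1: (Some @: K) = K.
Proof. by apply/setP => j; rewrite inE mem_imSome. Qed.

Lemma blowup_sP (J' : {set option I}) :
  (J' \in blowup_s) =
  [&& None \notin J', Some @^-1: J' \in H & ~~ (J \subset Some @^-1: J')].
Proof.
apply/imsetP/and3P => [[K + ->]|[nJ HJ sJ]].
  by rewrite preimSomeK None_imSome inE => /andP[].
by exists (Some @^-1: J'); rewrite ?imSomeK // inE HJ.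
Qed.

Lemma blowup_inf_atP (J' : {set option I}) (K : {set I}) : J \subset K ->
  (J' \in blowup_inf_at K) =
  [&& None \in J', ~~ (J \subset Some @^-1: J') & Some @^-1: J' :|: J == K].
Proof.
move=> JK; apply/imsetP/and3P => [[A + ->]|[nJ sJ /eqP KE]].
  rewrite inE => /fintype.properP[AJ [j jJ jA]]; split; first by rewrite !inE eqxx.
    apply/fintype.subsetPn; exists j => //.
    by rewrite !inE mem_imSome !inE jJ (negbTE jA).
  apply/eqP/setP => i; rewrite !inE mem_imSome !inE.
  have /implyP := fintype.subsetP AJ i; have /implyP := fintype.subsetP JK i.
  by case: (i \in J); case: (i \in A); case: (i \in K).
exists (Some @^-1: J' :&: J).
  rewrite inE fintype.properE finset.subsetIr /=; apply: contra sJ => /fintype.subset_trans.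
  by apply; exact: finset.subsetIl.
apply/setP => -[i|]; last by rewrite !inE nJ.
rewrite !inE mem_imSome -KE !inE.
by case: (i \in J); case: (Some i \in J').
Qed.

Lemma blowup_infP (J' : {set option I}) :
  (J' \in blowup_inf) =
  [&& None \in J', ~~ (J \subset Some @^-1: J') & Some @^-1: J' :|: J \in H].
Proof.
apply/bigcupP/and3P => [[K /andP[KH JK]]|[nJ sJ HJ]].
  by rewrite blowup_inf_atP // => /and3P[-> -> /eqP ->].
exists (Some @^-1: J' :|: J); first by rewrite HJ finset.subsetUr.
by rewrite blowup_inf_atP ?finset.subsetUr // nJ sJ eqxx.
Qed.

Lemma blowup_map_inf (J' : {set option I}) (K : {set I}) :
  K \in H -> J \subset K -> J' \in blowup_inf_at K -> blowup_map J' = K.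
Proof.
move=> KH JK JK'; rewrite /blowup_map; case: pickP => [L|/(_ K)]; last first.
  by rewrite /= KH JK JK'.
case/and3P=> _ JL; move: JK'; rewrite !blowup_inf_atP //.
by case/and3P => _ _ /eqP <- /and3P[_ _ /eqP ->].
Qed.

Lemma blowup_map_s (J' : {set option I}) :
  J' \in blowup_s -> blowup_map J' = Some @^-1: J'.
Proof.
rewrite blowup_sP /blowup_map => /and3P[nJ _ _].
case: pickP => // K /and3P[_ JK]; rewrite blowup_inf_atP //.
by rewrite (negbTE nJ).
Qed.

Lemma blowup_mapE (J' : {set option I}) :
  J' \in blowup_inf -> blowup_map J' = Some @^-1: J' :|: J.
Proof.
rewrite blowup_infP => /and3P[nJ sJ HJ].
apply: blowup_map_inf; rewrite ?finset.subsetUr //.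
by rewrite blowup_inf_atP ?finset.subsetUr // nJ sJ eqxx.
Qed.

End BlowUpSets.

Lemma blowup_strata_down (F : support_fabric) (J : {set index_set F})
    (K L : {set option (index_set F)}) :
  K \in blowup_strata (strata F) J -> L \subset K ->
  L \in blowup_strata (strata F) J.
Proof.
move=> KH LK.
have LK' : Some @^-1: L \subset Some @^-1: K by exact: finset.preimsetS.
have nJ : ~~ (J \subset Some @^-1: K) -> ~~ (J \subset Some @^-1: L).
  by apply: contra => /fintype.subset_trans; apply.
move: KH; rewrite !inE !blowup_sP !blowup_infP.
have [nL|nL] /= := boolP (None \in L).
  rewrite (fintype.subsetP LK) //= => /andP[/nJ -> KH].
  by apply: strata_down KH _; exact: finset.setSU.
case/orP => [/and3P[_ KH /nJ ->]|/and3P[_ /nJ -> KH]];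
  rewrite andbT orbF; apply: strata_down KH _ => //.
by apply: fintype.subset_trans LK' _; exact: finset.subsetUl.
Qed.

Definition blowup (F : support_fabric) (J : {set index_set F}) : support_fabric :=
  SupportFabric (@blowup_strata_down F J).

Section Polyhedra.
Variable R : realType.

(* For a subset J of I, the space R^J is realized as the coordinate subspace
   [coord_space J] of R^I, consisting of the functions vanishing outside J. *)
Notation "''R^' I" := {ffun I -> R^o} (at level 8, I at level 2).

Definition coord_space (I : finType) (J : {set I}) : set 'R^I :=
  [set s | forall i, i \notin J -> s i = 0].

Definition orthant (I : finType) (J : {set I}) : set 'R^I :=
  [set s | coord_space J s /\ forall i, 0 <= s i].

Definition convex_hull (V : lmodType R) (A : set V) : set V :=
  smallest (@convex_set R V) A.

(* [[A]], for A contained in [orthant J] *)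
Definition positive_hull (I : finType) (J : {set I}) (A : set 'R^I) : set 'R^I :=
  convex_hull [set a + b | a in A & b in orthant J].

Definition lattice_orthant (I : finType) (J : {set I}) (d : nat) : set 'R^I :=
  [set s | orthant J s /\ forall i, exists n : nat, s i = n%:R / d%:R].

Definition characteristic_polyhedron (I : finType) (J : {set I}) (d : nat)
    (D : set 'R^I) : Prop :=
  D !=set0 /\
  exists2 A : set 'R^I, A `<=` lattice_orthant J d & D = positive_hull J A.

(* the projection R^K -> R^J *)
Definition restrict (I : finType) (J : {set I}) (s : 'R^I) : 'R^I :=
  [ffun i => if i \in J then s i else 0].

(* The values of [poly] outside the strata are irrelevant. *)
Record polyhedra_system := PolyhedraSystem {
  fabric : support_fabric;
  poly : {set index_set fabric} -> set 'R^(index_set fabric);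
  denom : nat;
  denom_gt0 : (0 < denom)%N;
  poly_char : forall J, J \in strata fabric ->
    characteristic_polyhedron J denom (poly J);
  poly_proj : forall J1 J2, J1 \in strata fabric -> J2 \in strata fabric ->
    J1 \subset J2 -> poly J1 = restrict J1 @` poly J2
}.

Definition newton_system (N : polyhedra_system) : Prop := denom N = 1%N.

(* lambda_{J'} : R^K -> R^{J'} *)
Definition blowup_lambda (I : finType) (J : {set I}) (J' : {set option I})
    (s : 'R^I) : 'R^(option I) :=
  [ffun o => if o \in J' then
               if o is Some j then s j else \sum_(j in J) s j
             else 0].

(* the identification of R^K, K a subset of I, with R^(Some @: K) *)
Definition extend (I : finType) (s : 'R^I) : 'R^(option I) :=
  [ffun o => if o is Some j then s j else 0].

Definition transform_poly (D : polyhedra_system) (J : {set index_set (fabric D)})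
    (J' : {set option (index_set (fabric D))}) : set 'R^(option (index_set (fabric D))) :=
  let K := blowup_map (strata (fabric D)) J J' in
  if J' \in blowup_inf (strata (fabric D)) J
  then positive_hull J' (blowup_lambda J J' @` poly K)
  else @extend _ @` poly K.

Section Hulls.

Definition lin2 (V W : lmodType R) (f : V -> W) :=
  forall (a b : R) x y, f (a *: x + b *: y) = a *: f x + b *: f y.

Lemma convex_hull_convex (V : lmodType R) (A : set V) :
  convex_set (convex_hull A).
Proof.
move=> x y l /set_mem xA /set_mem yA; apply/mem_set => B [cB AB].
by apply/set_mem/cB; apply/mem_set; [exact: xA|exact: yA].
Qed.

Lemma convex_hull_image (V W : lmodType R) (f : V -> W) (A : set V) :
  lin2 f -> f @` convex_hull A = convex_hull (f @` A).
Proof.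
move=> fl; apply/seteqP; split.
  move=> _ [x xA <-] B [cB AB].
  suff : (f @^-1` B) x by [].
  apply: xA; split; last by move=> a aA; apply: AB; exists a.
  move=> u v l /set_mem uB /set_mem vB; apply/mem_set.
  rewrite /preimage /= /conv /= fl; apply/set_mem/cB; exact/mem_set.
apply: smallest_sub; last by apply: image_subset; exact: sub_gen_smallest.
move=> _ _ l /set_mem[x xA <-] /set_mem[y yA <-]; apply/mem_set.
exists (conv l (x : convex_lmodType V) y); last by rewrite /conv /= fl.
by apply/set_mem/convex_hull_convex; exact/mem_set.
Qed.

Lemma image_addset (V W : lmodType R) (f : V -> W) (A B : set V) : lin2 f ->
  f @` [set a + b | a in A & b in B] =
  [set a + b | a in f @` A & b in f @` B].
Proof.
move=> fl.
have fD x y : f (x + y) = f x + f y by have := fl 1 1 x y; rewrite !scale1r.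
apply/seteqP; split.
  by move=> _ [_ [a aA [b bB <-]] <-]; exists (f a); [exists a|
    exists (f b); [exists b|rewrite fD]].
move=> _ [_ [a aA <-] [_ [b bB <-] <-]]; exists (a + b); last exact: fD.
by exists a => //; exists b.
Qed.

Lemma orthant0 (I : finType) (J : {set I}) : orthant J 0.
Proof. by split=> i *; rewrite ffunE. Qed.

Lemma orthantD (I : finType) (J : {set I}) s t :
  orthant J s -> orthant J t -> orthant J (s + t).
Proof.
move=> [sJ s0] [tJ t0]; split=> i *; rewrite ffunE; last exact: addr_ge0.
by rewrite sJ // tJ // addr0.
Qed.

Lemma orthant_convex (I : finType) (J : {set I}) :
  convex_set (@orthant I J).
Proof.
move=> x y l /set_mem[xJ x0] /set_mem[yJ y0]; apply/mem_set; split=> i.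
  by move=> iJ; rewrite !ffunE xJ // yJ // !scaler0 addr0.
by rewrite !ffunE addr_ge0 // mulr_ge0 //= onem_ge0.
Qed.

Lemma sub_positive_hull (I : finType) (J : {set I}) (A : set 'R^I) :
  A `<=` positive_hull J A.
Proof.
move=> a aA; apply: sub_gen_smallest; exists a => //; exists 0; last exact: addr0.
exact: orthant0.
Qed.

Lemma positive_hullD (I : finType) (J : {set I}) (A : set 'R^I) x o :
  positive_hull J A x -> orthant J o -> positive_hull J A (x + o).
Proof.
move=> xA oJ.
suff : positive_hull J A `<=` [set y | positive_hull J A (y + o)] by exact.
apply: smallest_sub.
  move=> u v l /set_mem uA /set_mem vA; apply/mem_set => /=.
  have -> : conv l (u : convex_lmodType 'R^I) v + o =
      conv l (u + o : convex_lmodType 'R^I) (v + o).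
    by apply/ffunP => i; rewrite /conv /= !ffunE /onem /GRing.scale /=; ring.
  by apply/set_mem/convex_hull_convex; exact/mem_set.
move=> _ [a aA [b bJ <-]] /=; apply: sub_gen_smallest.
by exists a => //; exists (b + o); [exact: orthantD|rewrite addrA].
Qed.

Lemma positive_hull_image_onto (I I' : finType) (J : {set I}) (J' : {set I'})
    (f : 'R^I -> 'R^I') (A : set 'R^I) :
  lin2 f -> f @` orthant J = orthant J' ->
  f @` positive_hull J A = positive_hull J' (f @` A).
Proof.
by move=> fl fo; rewrite /positive_hull convex_hull_image // image_addset // fo.
Qed.

Lemma positive_hull_image (I I' : finType) (J : {set I}) (J' : {set I'})
    (f : 'R^I -> 'R^I') (A : set 'R^I) :
  lin2 f -> f @` orthant J `<=` orthant J' ->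
  positive_hull J' (f @` positive_hull J A) = positive_hull J' (f @` A).
Proof.
move=> fl fo; apply/seteqP; split; last first.
  apply: smallest_sub; first exact: convex_hull_convex.
  move=> _ [_ [a aA <-] [b bJ <-]]; apply: positive_hullD => //.
  by apply: sub_positive_hull; exists a => //; exact: sub_positive_hull.
apply: smallest_sub; first exact: convex_hull_convex.
move=> _ [_ [a aA <-] [b bJ <-]]; apply: positive_hullD => //.
suff : f @` positive_hull J A `<=` positive_hull J' (f @` A).
  by apply; exists a.
rewrite /positive_hull convex_hull_image // image_addset //.
apply: smallest_sub; first exact: convex_hull_convex.
move=> _ [u uA [v vJ <-]]; apply: positive_hullD; last exact: fo.
exact: sub_positive_hull.
Qed.

Lemma positive_hull_id (I : finType) (J : {set I}) (A : set 'R^I) :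
  positive_hull J (positive_hull J A) = positive_hull J A.
Proof.
have := @positive_hull_image I I J J id A.
by rewrite !image_id; apply.
Qed.

Lemma positive_hull_nonempty (I : finType) (J : {set I}) (A : set 'R^I) :
  A !=set0 -> positive_hull J A !=set0.
Proof. by move=> [a aA]; exists a; exact: sub_positive_hull. Qed.

Lemma lin2_restrict (I : finType) (J : {set I}) : lin2 (@restrict I J).
Proof.
move=> a b x y; apply/ffunP => i; rewrite !ffunE; case: ifP => // _.
by rewrite !scaler0 addr0.
Qed.

Lemma lin2_extend (I : finType) : lin2 (@extend I).
Proof.
move=> a b x y; apply/ffunP => -[i|]; rewrite !ffunE //.
by rewrite !scaler0 addr0.
Qed.

Lemma lin2_lambda (I : finType) (J : {set I}) J' : lin2 (@blowup_lambda I J J').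
Proof.
move=> a b x y; apply/ffunP => i; rewrite !ffunE; case: ifP => // _; last first.
  by rewrite !scaler0 addr0.
case: i => [i|]; first by rewrite !ffunE.
rewrite !scaler_sumr -big_split /=; apply: eq_bigr => j _.
by rewrite !ffunE.
Qed.

Lemma restrict_orthant (I : finType) (J1 J2 : {set I}) : J1 \subset J2 ->
  restrict J1 @` orthant J2 = orthant J1.
Proof.
move=> J12; apply/seteqP; split=> [_ [s [sJ s0] <-]|s [sJ s0]].
  split=> i; rewrite ffunE; first by move=> /negbTE ->.
  by case: ifP.
exists s; last first.
  by apply/ffunP => i; rewrite ffunE; case: ifPn => // /sJ.
by split=> // i iJ; apply: sJ; apply: contra iJ; exact/fintype.subsetP.
Qed.

Lemma extend_orthant (I : finType) (J' : {set option I}) : None \notin J' ->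
  @extend I @` orthant (Some @^-1: J') = orthant J'.
Proof.
move=> nJ; apply/seteqP; split=> [_ [s [sJ s0] <-]|s [sJ s0]].
  split=> -[i|]; rewrite ffunE // => iJ; apply: sJ; by rewrite inE.
exists [ffun i => s (Some i)].
  by split=> i; rewrite ?inE ffunE // => /sJ.
by apply/ffunP => -[i|]; rewrite !ffunE // sJ.
Qed.

Lemma lambda_orthant (I : finType) (J K : {set I}) (J' : {set option I}) :
  blowup_lambda J J' @` orthant K `<=` orthant J'.
Proof.
move=> _ [s [sJ s0] <-]; split=> i; rewrite ffunE; first by move=> /negbTE ->.
by case: ifP => // _; case: i => [i|]; [exact: s0|apply: sumr_ge0].
Qed.

Lemma lambda_lattice (I : finType) (J K : {set I}) (J' : {set option I}) d :
  blowup_lambda J J' @` lattice_orthant K d `<=` lattice_orthant J' d.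
Proof.
move=> _ [s [sK sd] <-]; split.
  by apply: lambda_orthant; exists s; first exact: sK.
move=> o; rewrite ffunE; case: ifP => _; last by exists 0%N; rewrite mul0r.
case: o => [j|]; first exact: sd.
elim/big_ind: _ => [|x y [m ->] [n ->]|//].
  by exists 0%N; rewrite mul0r.
by exists (m + n)%N; rewrite natrD mulrDl.
Qed.

Lemma extend_lattice (I : finType) (J' : {set option I}) d : None \notin J' ->
  @extend I @` lattice_orthant (Some @^-1: J') d `<=` lattice_orthant J' d.
Proof.
move=> nJ _ [s [sK sd] <-]; split; first by rewrite -extend_orthant //; exists s.
by move=> [i|]; rewrite ffunE //; exists 0%N; rewrite mul0r.
Qed.

Lemma restrict_lambda (I : finType) (J K1 : {set I}) (J1' J2' : {set option I}) s :
  J1' \subset J2' -> Some @^-1: J1' :|: J \subset K1 ->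
  restrict J1' (blowup_lambda J J2' s) = blowup_lambda J J1' (restrict K1 s).
Proof.
move=> J12; rewrite finset.subUset => /andP[/fintype.subsetP JK1 /fintype.subsetP JK].
apply/ffunP => o; rewrite !ffunE; case: ifP => // oJ.
rewrite (fintype.subsetP J12) //; case: o oJ => [i iJ|_].
  by rewrite ffunE JK1 // inE.
by apply: eq_bigr => j jJ; rewrite ffunE JK.
Qed.

Lemma restrict_lambda_extend (I : finType) (J : {set I})
    (J1' J2' : {set option I}) s : J1' \subset J2' -> None \notin J1' ->
  restrict J1' (blowup_lambda J J2' s) = extend (restrict (Some @^-1: J1') s).
Proof.
move=> J12 nJ; apply/ffunP => -[i|]; rewrite !ffunE; last by rewrite (negbTE nJ).
by rewrite inE; case: ifP => // iJ; rewrite (fintype.subsetP J12).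
Qed.

Lemma restrict_extend (I : finType) (J1' : {set option I}) s :
  None \notin J1' ->
  restrict J1' (extend s) = extend (restrict (Some @^-1: J1') s).
Proof.
move=> nJ; apply/ffunP => -[i|]; rewrite !ffunE ?inE //.
by rewrite (negbTE nJ).
Qed.

End Hulls.

Section TotalTransform.
Variables (D : polyhedra_system) (J : {set index_set (fabric D)}).
Let H := strata (fabric D).

Lemma transform_poly_char J' : J' \in strata (blowup J) ->
  characteristic_polyhedron J' (denom D) (transform_poly J J').
Proof.
rewrite inE /transform_poly -/H => J'H.
have [Jinf|Jninf] := boolP (J' \in blowup_inf H J).
  have KH : blowup_map H J J' \in H.
    by rewrite blowup_mapE //; move: Jinf; rewrite blowup_infP => /and3P[].
  have [[x xK] [A Ad KE]] := poly_char KH.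
  split; first by apply: positive_hull_nonempty; exists (blowup_lambda J J' x); exists x.
  exists (blowup_lambda J J' @` A).
    by move=> _ [a /Ad aA <-]; apply: lambda_lattice; exists a; first exact: aA.
  rewrite KE positive_hull_image //; first exact: lin2_lambda.
  exact: lambda_orthant.
move: J'H; rewrite (negbTE Jninf) orbF => Js.
have := Js; rewrite blowup_sP blowup_map_s // => /and3P[nJ KH _].
have [[x xK] [A Ad KE]] := poly_char KH.
split; first by exists (extend x); exists x.
exists (@extend _ @` A).
  by move=> _ [a /Ad aA <-]; apply: extend_lattice => //; exists a.
by rewrite KE; apply: positive_hull_image_onto;
  [exact: lin2_extend|exact: extend_orthant].
Qed.

Lemma transform_poly_proj J1 J2 :
  J1 \in strata (blowup J) -> J2 \in strata (blowup J) -> J1 \subset J2 ->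
  transform_poly J J1 = restrict J1 @` transform_poly J J2.
Proof.
rewrite !inE /transform_poly -/H => J1H J2H J12.
have P12 : Some @^-1: J1 \subset Some @^-1: J2 by exact: finset.preimsetS.
have [J1inf|J1ninf] := boolP (J1 \in blowup_inf H J).
  have J1K := J1inf; rewrite blowup_infP in J1K; case/and3P: J1K => n1 _ K1.
  have n2 : None \in J2 by exact: (fintype.subsetP J12).
  have J2inf : J2 \in blowup_inf H J.
    by move: J2H; rewrite blowup_sP n2.
  have J2K := J2inf; rewrite blowup_infP in J2K; case/and3P: J2K => _ _ K2.
  rewrite J2inf !blowup_mapE // (poly_proj K1 K2) ?finset.setSU //.
  rewrite (positive_hull_image_onto _ (@lin2_restrict _ _) (restrict_orthant J12)).
  rewrite !image_comp; congr positive_hull; apply: eq_imagel => s _ /=.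
  by rewrite -(@restrict_lambda _ _ _ _ J2).
move: J1H; rewrite (negbTE J1ninf) orbF => J1s.
have := J1s; rewrite blowup_sP blowup_map_s // => /and3P[n1 K1 _].
have [J2inf|J2ninf] := boolP (J2 \in blowup_inf H J).
  have J2K := J2inf; rewrite blowup_infP in J2K; case/and3P: J2K => _ _ K2.
  rewrite (positive_hull_image_onto _ (@lin2_restrict _ _) (restrict_orthant J12)).
  have [_ [A _ KE]] := poly_char K1.
  rewrite -[LHS](_ : @extend _ @` positive_hull (Some @^-1: J1) (poly (Some @^-1: J1)) = _);
    last by rewrite KE positive_hull_id.
  rewrite (positive_hull_image_onto _ (@lin2_extend _) (extend_orthant n1)).
  rewrite blowup_mapE // (poly_proj K1 K2).
    rewrite !image_comp; congr positive_hull; apply: eq_imagel => s _ /=.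
    by rewrite restrict_lambda_extend.
  by apply: fintype.subset_trans P12 _; exact: finset.subsetUl.
move: J2H; rewrite (negbTE J2ninf) orbF => J2s.
have := J2s; rewrite blowup_sP blowup_map_s // => /and3P[n2 K2 _].
rewrite (poly_proj K1 K2) // !image_comp; apply: eq_imagel => s _ /=.
by rewrite restrict_extend.
Qed.

Definition total_transform : polyhedra_system :=
  @PolyhedraSystem (blowup J) (transform_poly J) (denom D)
    (denom_gt0 D) transform_poly_char transform_poly_proj.

End TotalTransform.

Definition is_total_transform (D D' : polyhedra_system) : Prop :=
  exists J : {set index_set (fabric D)},
    [/\ J \in strata (fabric D), J != finset.set0 & D' = total_transform J].

(* the extreme points, which are the vertices of a polyhedron *)
Definition is_vertex (V : lmodType R) (D : set V) (v : V) : Prop :=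
  D v /\ forall (x y : V) (t : R), D x -> D y -> 0 < t -> t < 1 ->
    v = t *: x + (1 - t) *: y -> x = v /\ y = v.

Definition normal_crossings (N : polyhedra_system) : Prop :=
  newton_system N /\
  forall J, J \in strata (fabric N) -> exists! v, is_vertex (poly J) v.

End Polyhedra.

(* Main.v *)
(* A generator of a polyhedron is a nonnegative integral functional, which is
   recorded by its values on the vertices of the fabric; the blow-up of C gives
   the new vertex the sum of the values on C. By Dickson's lemma finitely many
   generators suffice, and a polyhedron has a single vertex as soon as its
   generators are pairwise comparable on the stratum. Two generators are
   comparable on every stratum when their difference f has no edge {i, j} with
   f(i) > 0 > f(j). Blowing up such an edge with f(i) - f(j) maximal lowers first
   the number of edges attaining the maximum and eventually the maximum, and
   comparable pairs remain comparable, so the pairs can be treated one by one. *)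
From mathcomp Require Import all_boot all_order all_algebra.
From mathcomp Require Import boolp classical_sets reals.
From mathcomp Require Import zify ring lra.
Require Import Defs.

Set Implicit Arguments.
Unset Strict Implicit.
Unset Printing Implicit Defensive.

Import Order.TTheory GRing.Theory Num.Theory.

Local Open Scope classical_set_scope.
Local Open Scope ring_scope.

(** * Finite dominating sets for the product order on naturals *)

(** Induction on [l]: let [s] serve for the tail, with [M] the largest value of [c i] on [s]. Then
    [s] handles every [b] with [c i b >= M]; the other [b] fall into finitely many slices of
    constant [c i], each handled by the induction hypothesis. *)
Lemma dickson (X I : eqType) (c : I -> X -> nat) (l : seq I) (B : set X) :
  exists s : seq X, (forall a, a \in s -> B a) /\
    forall b, B b -> exists2 a, a \in s & {in l, forall i, (c i a <= c i b)%N}.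
Proof.
elim: l B => [|i l IHl] B.
  have [[b Bb]|nB] := pselect (exists b, B b); last first.
    by exists [::]; split=> // b Bb; case: nB; exists b.
  by exists [:: b]; split=> [a|b' _]; [rewrite inE => /eqP ->|exists b; rewrite ?inE].
have [s [sB sl]] := IHl B.
pose M := (\max_(a <- s) c i a)%N.
have [s' /all_and2[s'B s'l]] :=
  choice (fun m => IHl [set b | B b /\ c i b = m]).
exists (s ++ flatten [seq s' m | m <- iota 0 M]); split=> [a|b Bb].
  rewrite mem_cat => /orP[/sB //|/flattenP[_ /mapP[m _ ->]] /s'B[]//].
have [Mb|bM] := leqP M (c i b).
  have [a sa al] := sl _ Bb; exists a; first by rewrite mem_cat sa.
  move=> j; rewrite inE => /predU1P[->|/al //].
  by apply: leq_trans Mb; exact: leq_bigmax_seq.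
have [a sa al] := s'l (c i b) b (conj Bb erefl).
exists a; last by move=> j; rewrite inE => /predU1P[->|/al //]; have [_ ->] := s'B _ _ sa.
rewrite mem_cat; apply/orP; right; apply/flattenP; exists (s' (c i b)) => //.
by apply/map_f; rewrite mem_iota.
Qed.

(** * Sequences of total transforms *)

(** The index set changes at each step, so an inductive closure is easier to compose than an indexed
    sequence; it is unfolded into one only at the end. *)
Inductive total_transforms (R : realType) (D : polyhedra_system R) :
    polyhedra_system R -> Prop :=
| total_transforms_refl : total_transforms D D
| total_transforms_step (D' D'' : polyhedra_system R) :
    is_total_transform D D' -> total_transforms D' D'' -> total_transforms D D''.

Arguments total_transforms_refl {R D}.

Lemma total_transforms_trans (R : realType) (D1 D2 D3 : polyhedra_system R) :
  total_transforms D1 D2 -> total_transforms D2 D3 -> total_transforms D1 D3.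
Proof.
elim=> // D D' D'' DD' _ IH /IH; exact: total_transforms_step.
Qed.

Lemma total_transforms_sequence (R : realType) (D D' : polyhedra_system R) :
  total_transforms D D' ->
  exists (k : nat) (Ns : nat -> polyhedra_system R),
    [/\ Ns 0%N = D,
        forall i : nat, (i < k)%N -> is_total_transform (Ns i) (Ns i.+1)
      & Ns k = D'].
Proof.
elim=> [E|E E' E'' EE' _ [k [Ns [Ns0 Nsk Nk]]]]; first by exists 0%N, (fun=> E).
exists k.+1, (fun i => if i is j.+1 then Ns j else E); split=> // -[_|i /Nsk //].
by rewrite Ns0.
Qed.

Lemma total_transforms_newton (R : realType) (D D' : polyhedra_system R) :
  total_transforms D D' -> newton_system D -> newton_system D'.
Proof. by elim=> // E E' E'' [J [_ _ ->]]. Qed.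

(** * Generators and their values after a blow-up *)

Definition natvec (R : realType) (I : finType) (v : I -> nat) : {ffun I -> R^o} :=
  [ffun i => (v i)%:R].

Section Generators.
Variables (R : realType) (T : eqType).

(* [g t i] is the value of the generator [t] on the primitive vector of the
   ray [i]; each polyhedron is spanned by one of the families in [E]. *)
Definition generated (E : seq (seq T)) (D : polyhedra_system R)
    (g : T -> index_set (fabric D) -> nat) : Prop :=
  forall K, K \in strata (fabric D) -> exists2 A, A \in E &
    poly K = positive_hull K [set restrict K (natvec R (g t)) | t in [set` A]].

Definition blowup_val (I : finType) (C : {set I}) (v : I -> nat) (o : option I) : nat :=
  if o is Some i then v i else (\sum_(j in C) v j)%N.

(** [blowup_lambda] carries the vector of a generator to that of its [blowup_val]; restricting to a
    stratum containing [C] does not alter the sum over [C]. So the families [E] stay fixed and only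
    the valuation of the labels changes. *)
Lemma generated_blowup (E : seq (seq T)) (D : polyhedra_system R)
    (g : T -> index_set (fabric D) -> nat) (C : {set index_set (fabric D)}) :
  generated E g ->
  @generated E (total_transform C) (fun t => blowup_val C (g t)).
Proof.
move=> gE K' /= K'H; rewrite /transform_poly.
have [Kinf|Kninf] := boolP (K' \in blowup_inf _ C).
  have := Kinf; rewrite blowup_infP => /and3P[_ _ KH].
  have [A AE KA] := gE _ KH; exists A => //.
  rewrite blowup_mapE // KA positive_hull_image;
    [|exact: lin2_lambda|exact: lambda_orthant].
  rewrite image_comp; congr positive_hull; apply: eq_imagel => t _ /=.
  apply/ffunP => o; rewrite !ffunE; case: ifP => // oK.
  case: o oK => [i iK|_] /=; first by rewrite !ffunE !inE iK.
  rewrite natr_sum; apply: eq_bigr => j jC.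
  by rewrite !ffunE !inE jC orbT.
move: K'H; rewrite inE (negbTE Kninf) orbF => Ks.
have := Ks; rewrite blowup_sP blowup_map_s // => /and3P[nK KH _].
have [A AE KA] := gE _ KH; exists A => //.
rewrite KA (positive_hull_image_onto _ (@lin2_extend _ _) (extend_orthant _ nK)).
rewrite image_comp; congr positive_hull; apply: eq_imagel => t _ /=.
by apply/ffunP => -[i|]; rewrite !ffunE ?inE ?(negbTE nK) //= !ffunE.
Qed.

(** * Bad edges and comparability under blow-up *)

Definition bad_edge (F : support_fabric) (v w : index_set F -> nat) i j : bool :=
  [&& [set i; j]%SET \in strata F, (w i < v i)%N & (v j < w j)%N].

(** On a bad edge both truncated differences are exact and positive: with f = v - w this is f(i) -
    f(j), at least 2. *)
Definition edge_weight (I : Type) (v w : I -> nat) i j : nat :=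
  ((v i - w i) + (w j - v j))%N.

Definition comparable_on (F : support_fabric) (v w : index_set F -> nat) : Prop :=
  forall i j, ~~ bad_edge v w i j.

(** Away from the new vertex no edge is created, and the center itself is destroyed when it is an
    edge. *)
Lemma blowup_edge_Some (F : support_fabric) (C : {set index_set F}) i j :
  [set Some i; Some j]%SET \in strata (blowup C) ->
  [set i; j]%SET \in strata F /\ ~~ (C \subset [set i; j]%SET).
Proof.
have -> : [set Some i; Some j]%SET = Some @: [set i; j]%SET.
  by rewrite imsetU1 imset_set1.
by rewrite inE blowup_sP blowup_infP preimSomeK None_imSome /= orbF => /andP.
Qed.

(** The edge comes from the old stratum formed by [C] and [k], which has all these pairs as
    faces. *)
Lemma blowup_edge_None (F : support_fabric) (C : {set index_set F}) i k :
  [set None; Some k]%SET \in strata (blowup C) -> i \in C ->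
  [set i; k]%SET \in strata F.
Proof.
rewrite inE blowup_sP blowup_infP !inE eqxx /= => /andP[_ CH] iC.
apply: strata_down CH _; apply/fintype.subsetP => x; rewrite !inE.
by case/pred2P => ->; rewrite ?iC ?eqxx ?orbT.
Qed.

Lemma sum_lt_exists (I : finType) (C : {set I}) (v w : I -> nat) :
  (\sum_(j in C) v j < \sum_(j in C) w j)%N -> exists2 j, j \in C & (v j < w j)%N.
Proof.
move=> lt_vw; have [/exists_inP//|/exists_inPn nC] :=
  boolP [exists j in C, v j < w j]%N.
move: lt_vw; rewrite ltnNge => /negP[]; apply: leq_sum => j /nC.
by rewrite -leqNgt.
Qed.

(** A strict inequality between sums over [C] is already strict at some [k] in [C]. Replacing the
    new vertex by this [k] turns a bad edge through it into an old bad edge. *)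
Lemma comparable_on_blowup (F : support_fabric) (C : {set index_set F})
    (v w : index_set F -> nat) :
  comparable_on v w -> @comparable_on (blowup C) (blowup_val C v) (blowup_val C w).
Proof.
move=> vw [i|] [j|]; apply/negP => /and3P[/= ijH vi vj].
- have [ijF _] := blowup_edge_Some ijH.
  by have /negP[] := vw i j; apply/and3P; split.
- rewrite finset.setUC in ijH; have [k kC vk] := sum_lt_exists vj.
  have /negP[] := vw i k; apply/and3P; split=> //.
  by rewrite finset.setUC; exact: blowup_edge_None ijH kC.
- have [k kC vk] := sum_lt_exists vi.
  have /negP[] := vw k j; apply/and3P; split=> //.
  exact: blowup_edge_None ijH kC.
- by move: (ltn_trans vi vj); rewrite ltnn.
Qed.

(** * Elimination of bad edges by descent *)

Definition heavy_edges (F : support_fabric) (v w : index_set F -> nat) (M : nat) :=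
  [set e : index_set F * index_set F |
    bad_edge v w e.1 e.2 && (edge_weight v w e.1 e.2 == M)]%SET.

(* The new vertex of the blow-up of a bad edge of maximal weight lies strictly
   between its ends, so every bad edge through it is lighter than the bad edge
   it comes from. *)
Lemma heavy_edges_blowup (F : support_fabric) (v w : index_set F -> nat) M i j
    (C := [set i; j]%SET) :
  (forall i' j', bad_edge v w i' j' -> (edge_weight v w i' j' <= M)%N) ->
  (i, j) \in heavy_edges v w M ->
  (forall i' j', @bad_edge (blowup C) (blowup_val C v) (blowup_val C w) i' j' ->
     (edge_weight (blowup_val C v) (blowup_val C w) i' j' <= M)%N) /\
  (#|@heavy_edges (blowup C) (blowup_val C v) (blowup_val C w) M|
     < #|heavy_edges v w M|)%N.
Proof.
move=> le_M; rewrite inE /= => /andP[ij_bad /eqP ij_M].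
have /and3P[ijH vi vj] := ij_bad.
have ij : i != j by apply: contraTneq vi => ->; rewrite -leqNgt ltnW.
have iC : i \in C by rewrite !inE eqxx.
have jC : j \in C by rewrite !inE eqxx orbT.
have sumC (u : index_set F -> nat) : (\sum_(k in C) u k = u i + u j)%N.
  by rewrite big_setU1 ?big_set1 // inE.
have Some_bad a b :
    @bad_edge (blowup C) (blowup_val C v) (blowup_val C w) (Some a) (Some b) ->
    bad_edge v w a b /\ (a, b) != (i, j).
  case/and3P=> /= /blowup_edge_Some[abH nC] va vb; split; first exact/and3P.
  by apply: contraNneq nC => -[-> ->].
have None_light a b : (a == None) || (b == None) ->
    @bad_edge (blowup C) (blowup_val C v) (blowup_val C w) a b ->
    (edge_weight (blowup_val C v) (blowup_val C w) a b < M)%N.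
  case: a b => [a|] [b|] // _ /and3P[/= abH];
    rewrite /edge_weight /= ?sumC => va vb.
  (* With f = v - w, the new value f(i) + f(j) is greater than f(j), so this edge is lighter than
     the old edge from [a] to [j]; the next case compares with the edge from [i] to [b]. *)
  - rewrite finset.setUC in abH; have := blowup_edge_None abH jC.
    rewrite finset.setUC => ajH.
    have := le_M a j; rewrite /bad_edge ajH va vj /edge_weight => /(_ isT).
    by lia.
  - have ibH := blowup_edge_None abH iC.
    have := le_M i b; rewrite /bad_edge ibH vi vb /edge_weight => /(_ isT).
    by lia.
  - by lia.
split.
  case=> [a|] [b|] ab; try by apply/ltnW/None_light.
  by have [/le_M] := Some_bad _ _ ab.
(* The new heavy edges avoid [None], hence lie in the image of the old ones under [f], which also
   contains the destroyed edge. *)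
pose f (e : index_set F * index_set F) := (Some e.1, Some e.2).
have f_inj : injective f by move=> [? ?] [? ?] [-> ->].
rewrite -(card_imset (mem (heavy_edges v w M)) f_inj).
apply/proper_card/fintype.properP; split.
  apply/fintype.subsetP => -[a b]; rewrite inE /= => /andP[ab_bad /eqP ab_M].
  case: a b ab_bad ab_M => [a|] [b|] ab_bad ab_M;
    try by move/None_light: ab_bad; rewrite ab_M ltnn => /(_ isT).
  apply/imsetP; exists (a, b) => //; have [ab _] := Some_bad _ _ ab_bad.
  by rewrite inE /= ab -ab_M eqxx.
exists (f (i, j)); first by rewrite mem_imset // inE /= ij_bad ij_M eqxx.
rewrite inE; apply/negP => /andP[/Some_bad[_]]; by rewrite eqxx.
Qed.

(* Induction on the maximal weight of a bad edge, then on the number of bad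
   edges attaining it. *)
Lemma make_comparable (E : seq (seq T)) (D : polyhedra_system R)
    (g : T -> index_set (fabric D) -> nat) (t u : T) :
  generated E g ->
  exists (D' : polyhedra_system R) (g' : T -> index_set (fabric D') -> nat),
  [/\ total_transforms D D', generated E g', comparable_on (g' t) (g' u)
    & forall t' u', comparable_on (g t') (g u') -> comparable_on (g' t') (g' u')].
Proof.
move=> gE.
have [M [n [le_M le_n]]] : exists M n,
    (forall i j, bad_edge (g t) (g u) i j -> (edge_weight (g t) (g u) i j <= M)%N) /\
    (#|heavy_edges (g t) (g u) M| <= n)%N.
  exists (\max_i \max_j edge_weight (g t) (g u) i j)%N; eexists; split; last exact: leqnn.
  move=> i j _; apply: leq_trans (leq_bigmax i).
  exact: (leq_bigmax (F := fun j => edge_weight (g t) (g u) i j)).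
elim: M n D g gE le_M le_n => [|M IHM] n.
  move=> D' g' gE le_M _; exists D', g'; split=> //; first exact: total_transforms_refl.
  move=> i j; apply/negP => ij; have := le_M _ _ ij.
  by case/and3P: ij => _; rewrite /edge_weight; lia.
elim: n => [|n IHn] D' g' gE le_M le_n.
  (* No bad edge of weight [M.+1] is left, so [M] bounds all weights and the count restarts with the
     edges of weight [M]. *)
  apply: (IHM _ _ _ gE _ (leqnn _)) => i j ij; rewrite -ltnS ltn_neqAle le_M // andbT.
  apply/negP => ijM; move: le_n; rewrite leqn0 cards_eq0 => /eqP/setP/(_ (i, j)).
  by rewrite !inE /= ij ijM.
have [e_0|[[i j] ij]] := set_0Vmem (heavy_edges (g' t) (g' u) M.+1).
  by apply: IHn => //; rewrite e_0 cards0.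
have [le_M' lt_n] := heavy_edges_blowup le_M ij.
have [|D'' [g'' [D'D'' gE'' tu'' g''P]]] :=
  IHn _ _ (generated_blowup (C := [set i; j]%SET) gE) le_M'.
  by rewrite -ltnS; exact: leq_trans lt_n le_n.
exists D'', g''; split=> // [|t' u' tu']; last exact/g''P/comparable_on_blowup.
apply: total_transforms_step D'D''; exists [set i; j]%SET; split=> //.
  by move: ij; rewrite inE => /andP[/and3P[]].
by apply/set0Pn; exists i; rewrite !inE eqxx.
Qed.

(** The labels in [T] survive every blow-up, so the list of pairs can be fixed in advance and
    treated one pair at a time. *)
Lemma make_all_comparable (E : seq (seq T)) (L : seq (T * T)) (D : polyhedra_system R)
    (g : T -> index_set (fabric D) -> nat) :
  generated E g ->
  exists (D' : polyhedra_system R) (g' : T -> index_set (fabric D') -> nat),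
  [/\ total_transforms D D', generated E g' &
    forall t u, (t, u) \in L -> comparable_on (g' t) (g' u)].
Proof.
elim: L D g => [|[t u] L IHL] D g gE; first by exists D, g; split=> //; left.
have [D1 [g1 [DD1 g1E L1]]] := IHL D g gE.
have [D2 [g2 [DD2 g2E tu2 g2P]]] := make_comparable t u g1E.
exists D2, g2; split=> //; first exact: total_transforms_trans DD1 DD2.
by move=> t' u'; rewrite inE => /predU1P[[-> ->] //|/L1/g2P].
Qed.

(** * Least generators on a stratum *)

(** Failure of both inequalities is witnessed by two elements of [K], which span a bad edge because
    strata are closed under subsets. *)
Lemma comparable_on_stratum (F : support_fabric) (v w : index_set F -> nat) K :
  comparable_on v w -> K \in strata F ->
  (forall i, i \in K -> (v i <= w i)%N) \/ (forall i, i \in K -> (w i <= v i)%N).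
Proof.
move=> vw KF; have [/forall_inP|] := boolP [forall i in K, v i <= w i]%N; first by left.
case/forall_inPn => i iK; rewrite -ltnNge => vi; right=> j jK.
rewrite leqNgt; apply/negP => vj; have /negP[] := vw i j; apply/and3P; split=> //.
by apply: strata_down KF _; apply/fintype.subsetP => x; rewrite !inE => /pred2P[] ->.
Qed.

Lemma exists_minimum (I : finType) (K : {set I}) (g : T -> I -> nat) (A : seq T) :
  (forall t u, t \in A -> u \in A ->
     (forall i, i \in K -> (g t i <= g u i)%N) \/
     (forall i, i \in K -> (g u i <= g t i)%N)) ->
  A != [::] ->
  exists2 m, m \in A & forall t, t \in A -> forall i, i \in K -> (g m i <= g t i)%N.
Proof.
elim: A => // a A IHA cmp _; have [->|A0] := eqVneq A [::].
  by exists a; rewrite ?inE // => t; rewrite inE => /eqP ->.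
have [|m mA mP] := IHA _ A0.
  by move=> t u tA uA; apply: cmp; rewrite inE ?tA ?uA orbT.
have mA' : m \in a :: A by rewrite inE mA orbT.
have [am|ma] := cmp a m (mem_head _ _) mA'.
  exists a => [|t]; first exact: mem_head.
  rewrite inE => /predU1P[-> //|tA i iK].
  exact: leq_trans (am i iK) (mP t tA i iK).
by exists m => // t; rewrite inE => /predU1P[-> //|]; exact: mP.
Qed.

End Generators.

(** * Hulls of one point and their vertices *)

Section Vertices.
Variables (R : realType) (I : finType).
Implicit Types (K : {set I}) (m : {ffun I -> R^o}) (A B : set {ffun I -> R^o}).

Lemma positive_hull_sub K A B :
  (forall a, A a -> exists2 b, B b & orthant K (a - b)) ->
  positive_hull K A `<=` positive_hull K B.
Proof.
move=> AB; apply: smallest_sub; first exact: convex_hull_convex.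
move=> _ [a /AB[b Bb ab] [o oK <-]]; have -> : a + o = b + ((a - b) + o).
  by rewrite addrA [b + _]addrC subrK.
by apply: positive_hullD; [exact: sub_positive_hull|exact: orthantD].
Qed.

Lemma positive_hull1 K m : positive_hull K [set m] = [set x | orthant K (x - m)].
Proof.
apply/seteqP; split=> [|x xm].
  apply: smallest_sub.
    move=> x y l /set_mem xm /set_mem ym; apply/mem_set => /=.
    have := @orthant_convex R I K (x - m) (y - m) l (mem_set xm) (mem_set ym).
    move/set_mem; congr orthant; apply/ffunP => i.
    by rewrite /convex.conv /= !ffunE /unstable.onem /GRing.scale /=; ring.
  by move=> _ [_ -> [o oK <-]] /=; rewrite addrC addKr.
have -> : x = m + (x - m) by rewrite addrC subrK.
by apply: positive_hullD => //; exact: sub_positive_hull.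
Qed.

Lemma positive_hull1_vertex K m :
  exists! v, is_vertex (positive_hull K [set m]) v.
Proof.
rewrite positive_hull1; exists m; split.
  split=> [|x y t [_ xm] [_ ym] t0 t1 mE] /=; first by rewrite subrr; exact: orthant0.
  suff xy i : x i = m i /\ y i = m i by split; apply/ffunP => i; case: (xy i).
  have := xm i; have := ym i; rewrite !ffunE => yi xi.
  have := congr1 (fun f : {ffun I -> R^o} => f i) mE; rewrite !ffunE /GRing.scale /= => mi.
  (* Two nonnegative terms with sum zero both vanish, and both coefficients are positive. *)
  have p : t * (x i - m i) + (1 - t) * (y i - m i) = 0.
    by rewrite {1 2}mi; nra.
  have p1 : 0 <= t * (x i - m i) by apply: mulr_ge0 => //; exact: ltW.
  have p2 : 0 <= (1 - t) * (y i - m i) by apply: mulr_ge0 => //; lra.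
  split; apply/eqP; rewrite -subr_eq0.
    have : t * (x i - m i) == 0 by apply/eqP; lra.
    by rewrite mulf_eq0 (gt_eqF t0).
  have : (1 - t) * (y i - m i) == 0 by apply/eqP; lra.
  by rewrite mulf_eq0 gt_eqF //=; lra.
(* Any [v] in the hull is the midpoint of [m] and [2v - m], both in the hull, so extremality forces
   [v = m]. *)
move=> v [vm vP]; have [] // := vP m (m + (v - m) *+ 2) 2^-1.
- by rewrite /= subrr; exact: orthant0.
- by rewrite /= addrC addKr mulr2n; exact: orthantD.
- by rewrite invr_gt0.
- by rewrite invf_lt1 // ltr1n.
- apply/ffunP => i; rewrite mulr2n !ffunE /GRing.scale /=.
  by field.
Qed.

End Vertices.

(** * Finite generation of Newton systems and conclusion *)

(** By [dickson], finitely many points of [A] have every point of [A] in their translated orthants.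
    Restriction to [K] fixes them, since points of [A] vanish outside [K]. *)
Lemma lattice_hull_finite (R : realType) (I : finType) (K : {set I})
    (A : set {ffun I -> R^o}) :
  A `<=` lattice_orthant K 1 ->
  exists s : seq {ffun I -> nat},
    positive_hull K A = positive_hull K [set restrict K (natvec R t) | t in [set` s]].
Proof.
move=> A_lat.
have [s [sA sP]] :=
  dickson (fun i (t : {ffun I -> nat}) => t i) (enum I) [set t | A (natvec R t)].
have restrictA a : A a -> restrict K a = a.
  by move=> /A_lat[[aK _] _]; apply/ffunP => i; rewrite ffunE; case: ifPn => // /aK.
exists s; apply/seteqP; split; apply: positive_hull_sub; last first.
  move=> _ [t /sA tA <-].
  by exists (natvec R t); rewrite ?restrictA // subrr; exact: orthant0.
move=> a aA; have [[aK _] /choice[n an]] := A_lat a aA.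
have aE : a = natvec R [ffun i => n i].
  by apply/ffunP => i; rewrite !ffunE an divr1.
have [|t ts tn] := sP [ffun i => n i]; first by rewrite /= -aE.
have tA := sA _ ts; have [[tK _] _] := A_lat _ tA.
exists (restrict K (natvec R t)); first by exists t.
rewrite restrictA //; split=> i; rewrite !ffunE.
  by move=> iK; have := tK i iK; rewrite ffunE => ->; rewrite aK // subr0.
by rewrite aE ffunE subr_ge0 ler_nat; apply: tn; rewrite mem_enum.
Qed.

(** Vectors on the original index set become the labels for all later systems, with the identity as
    initial valuation. *)
Lemma newton_generated (R : realType) (N : polyhedra_system R) :
  newton_system N ->
  exists E : seq (seq {ffun index_set (fabric N) -> nat}),
    generated E (fun t : {ffun index_set (fabric N) -> nat} => t).
Proof.
move=> N1.
have gens K : exists A : seq {ffun index_set (fabric N) -> nat},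
    K \in strata (fabric N) ->
    poly K = positive_hull K [set restrict K (natvec R t) | t in [set` A]].
  have [KH|] := boolP (K \in strata (fabric N)); last by exists [::].
  have [_ [A + ->]] := poly_char KH; rewrite N1 => /lattice_hull_finite[s ->].
  by exists s.
have [A AP] := choice gens.
exists [seq A K | K <- enum (strata (fabric N))] => K KH; exists (A K); last exact: AP.
by apply/map_f; rewrite mem_enum.
Qed.

(** A least generator [m] on [K] exists, and all the others lie in [m] plus the orthant, so the
    polyhedron is the hull of one point. *)
Lemma comparable_single_vertex (R : realType) (T : eqType) (E : seq (seq T))
    (D : polyhedra_system R) (g : T -> index_set (fabric D) -> nat) K :
  generated E g ->
  {in flatten E &, forall t u, comparable_on (g t) (g u)} ->
  K \in strata (fabric D) -> exists! v, is_vertex (poly K) v.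
Proof.
move=> gE cmp KH; have [B BE KB] := gE K KH.
have BT t : t \in B -> t \in flatten E by move=> tB; apply/flattenP; exists B.
have [||m mB mP] := @exists_minimum T _ K g B.
- by move=> t u /BT tE /BT uE; apply: comparable_on_stratum KH; exact: cmp.
(* An empty family would span the empty set, but polyhedra are non-empty. *)
- apply/eqP => B0; have [[x]] := poly_char KH; rewrite KB B0.
  suff sub0 : positive_hull K [set restrict K (natvec R (g t)) | t in [set` [::]]] `<=` set0.
    by move/sub0.
  by apply: smallest_sub => [? ? ? /set_mem|? [? []]].
suff -> : poly K = positive_hull K [set restrict K (natvec R (g m))].
  exact: positive_hull1_vertex.
rewrite KB; apply/seteqP; split; apply: positive_hull_sub.
  move=> _ [t tB <-]; exists (restrict K (natvec R (g m))) => //.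
  split=> i; rewrite !ffunE; first by move=> /negbTE ->; rewrite subrr.
  by case: ifP => [iK|]; rewrite ?subrr // subr_ge0 ler_nat; exact: mP.
move=> _ ->; exists (restrict K (natvec R (g m))); first by exists m.
by rewrite subrr; exact: orthant0.
Qed.

Theorem theorem1 (R : realType) (N : polyhedra_system R) (HN : newton_system N) :
  exists (k : nat) (Ns : nat -> polyhedra_system R),
    [/\ Ns 0%N = N,
        forall i : nat, (i < k)%N -> is_total_transform (Ns i) (Ns i.+1)
      & normal_crossings (Ns k)].
Proof.
have [E NE] := newton_generated HN.
(* Taking all pairs of labels from all families lets one sequence of blow-ups serve every stratum at
   once. *)
have [D [g [ND gE cmp]]] :=
  make_all_comparable [seq (t, u) | t <- flatten E, u <- flatten E] NE.
have [k [Ns [Ns0 NsS Nsk]]] := total_transforms_sequence ND.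
exists k, Ns; split=> //; rewrite Nsk; split; first exact: total_transforms_newton ND HN.
move=> K; apply: comparable_single_vertex gE _ => t u tE uE.
by apply: cmp; exact: allpairs_f.
Qed.
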